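(* Let $\mu$ be a Borel probability measure on $\mathbb{R}$ of the form $d\mu=g(x)\,dx$, with $|\widehat{g}(\xi)|=\mathcal{O}(|\xi|^{-\alpha})$ for some $\alpha>\frac12$. Suppose that there is a family $\{\Lambda_A:A>0\}$ of countable subsets of $\mathbb{R}$, each enumerated in strictly increasing order by $\mathbb{Z}$, such that for every $A>0$ $$\sum_{\lambda\in\Lambda_A}\Big|\int f(x)e^{-2\pi i\lambda x}\,d\mu(x)\Big|^2\ge A\int|f(x)|^2\,d\mu(x)\qquad\text{for all } f\in L^2(\mu).$$ Then $$\limsup_{A\to\infty}A\,g_{\min}(\Lambda_A)\le\int_{\mathbb{R}}|g(x)|^2\,dx.$$
   Context: The Fourier transform is $\widehat{g}(\xi)=\widehat{\mu}(\xi)=\int e^{-2\pi i\xi x}g(x)\,dx$; the $\mathcal{O}$ bound is as $|\xi|\to\infty$. For a set $\Lambda=\{\lambda_k\}_{k\in\mathbb{Z}}\subset\mathbb{R}$ with $\lambda_n<\lambda_m$ whenever $n<m$, the spectral gaps are $g_k(\Lambda):=\lambda_k-\lambda_{k-1}$, $k\in\mathbb{Z}$. The essential minimal spectral gap is $$g_{\min}(\Lambda):=\inf\{c\ge 0: g_k(\Lambda)<c\text{ for infinitely many }k\}.$$ *)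

(* Defs.v *)
From HB Require Import structures.
From mathcomp Require Import all_boot all_order all_algebra.
From mathcomp Require Import all_classical all_reals all_analysis.
From mathcomp Require Export complex.

Set Implicit Arguments.
Unset Strict Implicit.
Unset Printing Implicit Defensive.

Import Order.TTheory GRing.Theory Num.Theory.
Import numFieldNormedType.Exports.

Local Open Scope classical_set_scope.
Local Open Scope ring_scope.
Local Open Scope complex_scope.

Definition expi (R : realType) (t : R) : R[i] := cos t +i* sin t.

(* Componentwise, since the library integrates only real-valued functions; the
   value is meaningful when the real and imaginary parts are integrable. *)
Definition cintegral d (T : measurableType d) (R : realType)
    (mu : {measure set T -> \bar R}) (f : T -> R[i]) : R[i] :=
  (\int[mu]_x complex.Re (f x))%R +i* (\int[mu]_x complex.Im (f x))%R.

Definition fourier (R : realType)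
    (mu : {measure set (measurableTypeR R) -> \bar R}) (f : R -> R[i])
    (xi : R) : R[i] :=
  cintegral mu (fun x => f x * expi (- (2 * pi * xi * x))).

Definition complex_L2 d (T : measurableType d) (R : realType)
    (mu : {measure set T -> \bar R}) (f : T -> R[i]) : Prop :=
  [/\ measurable_fun setT (fun x => complex.Re (f x)),
      measurable_fun setT (fun x => complex.Im (f x)) &
      (\int[mu]_x (Normc.normc (f x) ^+ 2)%:E < +oo)%E].

Definition spectral_gap (R : realType) (lam : int -> R) (k : int) : R :=
  lam k - lam (k - 1).

(* Extended-real valued: +oo when no c qualifies, i.e. when the gaps tend to
   infinity in both directions. *)
Definition gmin (R : realType) (lam : int -> R) : \bar R :=
  ereal_inf [set c%:E | c in
    [set c : R | 0 <= c /\ infinite_set [set k | spectral_gap lam k < c]]].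

(* Main.v *)
Require Import Defs.
From mathcomp Require Import all_boot all_order all_algebra.
From mathcomp Require Import all_classical all_reals all_analysis.
From mathcomp Require Import measurable_realfun lebesgue_integral_under.
From mathcomp Require Import zify ring lra.

(** Put [h xi = |ghat xi| ^ 2]. Testing the frame inequality on the exponentials
    [x |-> exp (2 i pi t x)] gives [A <= \sum_k h (lam k - t)] for every real
    [t]. If [c < gmin], all but finitely many gaps are at least [c], so on a
    window of [n] consecutive points far to the right the terms other than
    [n + O(1)] of them contribute a tail that is uniformly small, because
    [h xi = O(|xi| ^ (-2 alpha))] with [2 alpha > 1]. Integrating over the window,
    whose length is at least [n c], yields [A n c <= (n + O(1)) \int h + o(n)],
    hence [A c <= \int h <= \int g ^ 2]. The theorem thus holds for each [A], not
    only in the limit.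

    The Plancherel inequality [\int h <= \int g ^ 2] is obtained with the weights
    [exp (- e |xi|)]: by Fubini, [\int h exp (- e |xi|)] is the quadratic form
    [\int\int g x g y P_e (x - y)] of the Poisson kernel, which is nonnegative of
    integral [1], so [2 g x g y <= g x ^ 2 + g y ^ 2] bounds it by [\int g ^ 2]. *)

Set Implicit Arguments.
Unset Strict Implicit.

Import Order.TTheory GRing.Theory Num.Theory.
Import numFieldNormedType.Exports.

Local Open Scope classical_set_scope.
Local Open Scope ring_scope.

(** * Laplace weights and the Poisson kernel *)

Section laplace.
Context {R : realType}.
Implicit Types e b x : R.
Notation leb := (@lebesgue_measure R).

Lemma is_derive_comp_scale (f : R -> R) (df b x : R) :
  is_derive (b * x) 1 f df -> is_derive x 1 (fun y => f (b * y)) (df * b).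
Proof.
move=> h; apply: (@is_derive1_comp _ f (fun y => b * y)) => //.
have -> : (fun y : R => b * y) = b \*: (@id R) by [].
by rewrite -[X in is_derive _ _ _ X]mulr1; exact: is_deriveZ.
Qed.

(* The summand [1] makes the integrand nonnegative, as required by
   [ge0_continuous_FTC2y]; it is subtracted in [Rintegral_expRNnorm_cos]. *)
Lemma integral_expR_1Dcos_ge0 e b : 0 < e ->
  (\int[leb]_(x in `[0%R, +oo[) (expR (- e * x) * (1 + cos (b * x)))%:E =
  (e^-1 + e / (e ^+ 2 + b ^+ 2))%:E)%E.
Proof.
move=> e0; set D := e ^+ 2 + b ^+ 2.
have D0 : D != 0 by rewrite gt_eqF// ltr_wpDr// ?sqr_ge0// exprn_gt0.
have en0 : e != 0 by rewrite gt_eqF.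
(* This antiderivative tends to 0 at infinity, so the integral equals [- F 0]. The term [- e^-1]
   accounts for the summand [1], the quotient by [D] for the cosine. *)
pose F x := expR (- e * x) * (- e^-1 + (b * sin (b * x) - e * cos (b * x)) / D).
have dF x : is_derive x 1 F (expR (- e * x) * (1 + cos (b * x))).
  have d1 : is_derive x 1 (fun x => expR (- e * x)) (expR (- e * x) * - e).
    exact: is_derive_comp_scale.
  have d2 : is_derive x 1 (fun x => cos (b * x)) (- sin (b * x) * b).
    exact: is_derive_comp_scale.
  have d3 : is_derive x 1 (fun x => sin (b * x)) (cos (b * x) * b).
    exact: is_derive_comp_scale.
  have -> : F = (fun x => expR (- e * x)) *
     (cst (- e^-1) + D^-1 \*: ((b \*: (fun x => sin (b * x))) - (e \*: (fun x => cos (b * x))))).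
    by apply/funext => y; rewrite /F !fctE/= /GRing.scale/= [D^-1 * _]mulrC.
  apply: is_derive_eq.
  rewrite !fctE /= -![_ *: _]/(_ * _); rewrite /D in D0 *; field.
  by rewrite D0 en0.
have cf : continuous (fun x => expR (- e * x) * (1 + cos (b * x))).
  move=> x; apply: cvgM.
    by apply: continuous_comp; [exact: mulrl_continuous|exact: continuous_expR].
  apply: cvgD; first exact: cvg_cst.
  by apply: continuous_comp; [exact: mulrl_continuous|exact: continuous_cos].
have cF x : {for x, continuous F}.
  by apply: differentiable_continuous; apply/derivable1_diffP;
    exact: (@ex_derive _ _ _ _ _ _ _ (dF x)).
rewrite (@ge0_continuous_FTC2y _ _ F _ 0); last 6 first.
- by move=> x _; rewrite mulr_ge0 ?expR_ge0.
- by apply: continuous_subspaceT.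
(* [M] bounds the bracket in [F] uniformly in [x], so [F] decays like the exponential. *)
- pose M := e^-1 + (`|b| + e) / D.
  have Dp : 0 < D by rewrite ltr_wpDr// ?sqr_ge0// exprn_gt0.
  have ce : expR (- (e * x)) @[x --> +oo] --> 0.
    apply: (@cvg_comp _ _ _ (fun x => e * x) (fun x => expR (- x)) _ (pinfty_nbhs R)); last exact: cvgr_expR.
    exact: gt0_cvgMry.
  apply/cvgr0Pnorm_le => d d0.
  have /cvgr0Pnorm_le/(_ (d / (M + 1))) := ce.
  have M0 : 0 <= M.
    apply: addr_ge0; first by rewrite invr_ge0 ltW.
    by apply: divr_ge0; [apply: addr_ge0|]; rewrite // ltW.
  have M1 : 0 < M + 1 by lra.
  move=> /(_ (divr_gt0 d0 M1)); apply: filterS => x.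
  rewrite /F normrM -mulNr => hx.
  rewrite -[leRHS](@divfK _ (M + 1)) ?gt_eqF//.
  apply: ler_pM => //.
  apply: (@le_trans _ _ M); last by lra.
  apply: (le_trans (ler_normD _ _)); rewrite /M normrN gtr0_norm ?invr_gt0// lerD2l.
  rewrite normrM (gtr0_norm (x := D^-1)) ?invr_gt0// ler_wpM2r ?invr_ge0 ?(ltW Dp)//.
  apply: (le_trans (ler_normB _ _)); rewrite !normrM (gtr0_norm e0).
  have := cos_max (b * x); have := sin_max (b * x).
  by move=> s1 c1; apply: lerD; rewrite ler_piMr// ltW.
- by move=> x _; exact: (@ex_derive _ _ _ _ _ _ _ (dF x)).
- by apply: cvg_at_right_filter; exact: cF.
- by move=> x _; rewrite derive1E; exact: (@derive_val _ _ _ _ _ _ _ (dF x)).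
- rewrite -EFinB; congr EFin; rewrite /F !mulr0 sin0 cos0 expR0; field.
  by rewrite D0 en0.
Qed.

Lemma continuous_expRNnorm e : continuous (fun x => expR (- e * `|x|)).
Proof.
move=> x; apply: continuous_comp; last exact: continuous_expR.
apply: cvgM; first exact: cvg_cst.
exact: norm_continuous.
Qed.

Lemma integral_expR_1Dcos e b : 0 < e ->
  (\int[leb]_x (expR (- e * `|x|) * (1 + cos (b * x)))%:E =
  (2 * (e^-1 + e / (e ^+ 2 + b ^+ 2)))%:E)%E.
Proof.
move=> e0; rewrite ge0_symfun_integralT.
- rewrite EFinM; congr (_ * _)%E; rewrite -integral_expR_1Dcos_ge0// set_itvcy.
  by apply: eq_integral => x; rewrite inE/= => x0; rewrite ger0_norm.
- by move=> x; rewrite mulr_ge0 ?expR_ge0.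
- move=> x; apply: cvgM; first exact: continuous_expRNnorm.
  apply: cvgD; first exact: cvg_cst.
  by apply: continuous_comp; [exact: mulrl_continuous|exact: continuous_cos].
- by move=> x; rewrite /= normrN mulrN cosN.
Qed.

(** At [b = 0] the integrand of [integral_expR_1Dcos] is twice this one, and the value there is
    [4 / e]. *)
Lemma integral_expRNnorm e : 0 < e ->
  (\int[leb]_x (expR (- e * `|x|))%:E = (2 / e)%:E)%E.
Proof.
move=> e0; have := @integral_expR_1Dcos e 0 e0.
under eq_integral do rewrite mul0r cos0 mulrC EFinM.
rewrite ge0_integralZl//; last first.
  apply/measurable_EFinP; apply: continuous_measurable_fun.
  exact: continuous_expRNnorm.
set I := (\int[_]_x _)%E => h.
have -> : I = ((2^-1)%:E * ((1 + 1)%:E * I))%E.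
  by rewrite muleA -EFinM [X in (X%:E)%E](_ : _ = 1) ?mul1e//; lra.
rewrite h -EFinM; congr EFin; field.
by rewrite gt_eqF// exprn_gt0.
Qed.

Lemma integrable_expRNnorm e : 0 < e ->
  leb.-integrable setT (fun x => (expR (- e * `|x|))%:E).
Proof.
move=> e0; apply/integrableP; split.
  apply/measurable_EFinP; apply: continuous_measurable_fun.
  exact: continuous_expRNnorm.
under eq_integral do rewrite gee0_abs ?lee_fin ?expR_ge0//.
by rewrite integral_expRNnorm// ltry.
Qed.

Lemma Rintegral_expRNnorm_cos e b : 0 < e ->
  \int[leb]_x (expR (- e * `|x|) * cos (b * x)) = 2 * e / (e ^+ 2 + b ^+ 2).
Proof.
move=> e0.
have i1 := @integrable_expRNnorm e e0.
have i2 : leb.-integrable setT (EFin \o (fun x => expR (- e * `|x|) * (1 + cos (b * x)))).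
  apply/integrableP; split.
    apply/measurable_EFinP; apply: continuous_measurable_fun.
    move=> x; apply: cvgM; first exact: continuous_expRNnorm.
    apply: cvgD; first exact: cvg_cst.
    by apply: continuous_comp; [exact: mulrl_continuous|exact: continuous_cos].
  under eq_integral => x _.
    rewrite gee0_abs ?lee_fin; last first.
      by rewrite mulr_ge0 ?expR_ge0.
    over.
  by rewrite integral_expR_1Dcos// ltry.
transitivity (\int[leb]_x (expR (- e * `|x|) * (1 + cos (b * x)) - expR (- e * `|x|))).
  by apply: eq_Rintegral => x _; ring.
rewrite RintegralB// /Rintegral integral_expR_1Dcos// integral_expRNnorm//=.
have : e ^+ 2 + b ^+ 2 != 0 by rewrite gt_eqF// ltr_wpDr// ?sqr_ge0// exprn_gt0.
by move=> n0; field; rewrite n0 gt_eqF.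
Qed.

(** The Fourier transform of exp (- e |xi|). With y = e / (2 pi) it is y / (pi (x ^ 2 + y ^ 2)), the
    Poisson kernel of the upper half-plane at height y. *)
Definition poisson (e x : R) : R := 2 * e / (e ^+ 2 + (2 * pi * x) ^+ 2).

Lemma poisson_ge0 e x : 0 < e -> 0 <= poisson e x.
Proof. by move=> e0; rewrite divr_ge0 ?addr_ge0 ?sqr_ge0// mulr_ge0// ltW. Qed.

Lemma poissonN e x : poisson e (- x) = poisson e x.
Proof. by rewrite /poisson mulrN sqrrN. Qed.

Lemma poisson_le e x : 0 < e -> poisson e x <= 2 / e.
Proof.
move=> e0; rewrite /poisson ler_pdivrMr; last by rewrite ltr_pwDl ?exprn_gt0 ?sqr_ge0.
rewrite mulrDr -[leLHS]addr0 lerD//; last by rewrite mulr_ge0 ?sqr_ge0 ?divr_ge0// ltW.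
by rewrite expr2 mulrA divfK// gt_eqF.
Qed.

Lemma continuous_poisson e : 0 < e ->
  continuous (poisson e).
Proof.
move=> e0 x; apply: cvgM; first exact: cvg_cst.
apply: cvgV; first by rewrite gt_eqF// ltr_wpDr// ?sqr_ge0// exprn_gt0.
apply: cvgD; first exact: cvg_cst.
apply: (@continuous_comp _ _ _ (fun x => 2 * pi * x) (fun x => x ^+ 2)).
  exact: mulrl_continuous.
exact: exprn_continuous.
Qed.

Lemma integral_poisson e : 0 < e ->
  (\int[leb]_x (poisson e x)%:E = 1)%E.
Proof.
move=> e0; have pi0 := pi_gt0 R.
rewrite ge0_symfun_integralT; last 3 first.
- by move=> x; exact: poisson_ge0.
- exact: continuous_poisson.
- by move=> x; rewrite /= poissonN.
pose c : R := 2 * pi / e.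
have c0 : 0 < c by rewrite divr_gt0 ?mulr_gt0.
(* [F] runs from 0 at the origin to 1/2 at infinity; the factor 2 from symmetry then gives 1. *)
pose F x := pi^-1 * atan (c * x).
have dF x : is_derive x 1 F (poisson e x).
  have d1 : is_derive x 1 (fun x => atan (c * x)) ((1 + (c * x) ^+ 2)^-1 * c).
    exact: is_derive_comp_scale.
  have -> : F = pi^-1 \*: (fun x => atan (c * x)) by [].
  apply: is_derive_eq; rewrite /GRing.scale/= /c /poisson.
  have n1 : e ^+ 2 + (2 * pi * x) ^+ 2 != 0.
    by rewrite gt_eqF// ltr_wpDr// ?sqr_ge0// exprn_gt0.
  (* [pi] is generalized because [field] would unfold it. *)
  by move: n1 pi0; move: (@pi R) => p n1 p0; field; rewrite n1 !gt_eqF.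
have cF x : {for x, continuous F}.
  by apply: differentiable_continuous; apply/derivable1_diffP;
    exact: (@ex_derive _ _ _ _ _ _ _ (dF x)).
rewrite -set_itvcy (@ge0_continuous_FTC2y _ _ F _ 2^-1).
- by rewrite /F mulr0 atan0 mulr0 -EFinB -EFinM; congr EFin; lra.
- by move=> x _; exact: poisson_ge0.
- exact/continuous_subspaceT/continuous_poisson.
- have -> : 2^-1 = pi^-1 * (pi / 2) :> R by rewrite mulrA mulVf ?mul1r// gt_eqF.
  apply: cvgM; first exact: cvg_cst.
  apply: (@cvg_comp _ _ _ (fun x => c * x) atan _ (pinfty_nbhs R)); last exact: cvgy_atan.
  exact: gt0_cvgMry.
- by move=> x _; exact: (@ex_derive _ _ _ _ _ _ _ (dF x)).
- by apply: cvg_at_right_filter; exact: cF.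
- by move=> x _; rewrite derive1E; exact: (@derive_val _ _ _ _ _ _ _ (dF x)).
Qed.

(** The preimage of ]a, b] under the reflection is [s - b, s - a[, of the same length. By
    uniqueness, Lebesgue measure is therefore its own image under the reflection. *)
Lemma ge0_integral_reflect (s : R) (f : R -> \bar R) :
  measurable_fun setT f -> (forall x, 0 <= f x)%E ->
  (\int[leb]_x f (s - x)%R = \int[leb]_x f x)%E.
Proof.
move=> mf f0.
have mphi : measurable_fun setT (fun x : measurableTypeR R => s - x : measurableTypeR R).
  apply: continuous_measurable_fun => x; apply: cvgB; first exact: cvg_cst.
  exact: cvg_id.
have := @ge0_integral_pushforward _ _ _ _ R
  (fun x : measurableTypeR R => s - x : measurableTypeR R) mphi leb setT f
  measurableT mf (fun x _ => f0 x).
rewrite preimage_setT => <-.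
apply: eq_measure_integral => //= A mA _; apply/esym/lebesgue_measure_unique => //= _ [[a b]] _ <-.
rewrite /pushforward.
have -> : (fun x => s - x) @^-1` `]a, b]%classic = `[s - b, s - a[%classic.
  by apply/seteqP; split=> x /=; rewrite !in_itv/= => /andP[? ?]; apply/andP; split; lra.
rewrite !lebesgue_measure_itv/= !lte_fin.
have -> : (s - b < s - a) = (a < b) by apply/idP/idP; lra.
by case: ifP => // _; rewrite -!EFinB; congr EFin; lra.
Qed.

End laplace.

(** * Fourier transforms of integrable functions *)

Lemma integrable_mul_bounded d (T : measurableType d) (R : realType)
    (mu : {measure set T -> \bar R}) (f u : T -> R) (M : R) :
  mu.-integrable setT (fun x => (f x)%:E) -> measurable_fun setT u ->
  (forall x, `|u x| <= M) -> mu.-integrable setT (fun x => (f x * u x)%:E).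
Proof.
move=> fi mu_ uM.
apply: (@eq_integrable _ _ _ _ _ measurableT ((EFin \o f) \* (EFin \o u))%E) => //.
apply: integrableMl => //; exists M; split; first exact: num_real.
by move=> y My x _; apply: (le_trans (uM x)); exact: ltW.
Qed.

Lemma EFin_Rintegral d (T : measurableType d) (R : realType)
    (mu : {measure set T -> \bar R}) (f : T -> R) :
  mu.-integrable setT (fun x => (f x)%:E) ->
  ((\int[mu]_x f x)%R%:E = \int[mu]_x (f x)%:E)%E.
Proof. by move=> fi; rewrite /Rintegral fineK//; exact: integrable_fin_num. Qed.

Section bounded_fubini.
Context {R : realType}.
Notation leb := (@lebesgue_measure R).
Implicit Types (f g : R -> R) (u : measurableTypeR R * measurableTypeR R -> R).

(** By Tonelli the integral of |f x * g y| factors into two finite integrals; a bounded factor [u]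
    preserves integrability. *)
Lemma integrable_prod_bounded f g u (M : R) :
  leb.-integrable setT (fun x => (f x)%:E) ->
  leb.-integrable setT (fun x => (g x)%:E) ->
  measurable_fun setT u -> (forall z, `|u z| <= M) ->
  (leb \x leb)%E.-integrable setT (fun z => (f z.1 * g z.2 * u z)%:E).
Proof.
move=> fi gi mu_ uM; apply: (integrable_mul_bounded (M := M)) => //.
have mf : measurable_fun setT f by have /integrableP[/measurable_EFinP] := fi.
have mg : measurable_fun setT g by have /integrableP[/measurable_EFinP] := gi.
apply/integrable12ltyP.
  apply/measurable_EFinP; apply: measurable_funM.
    exact: (measurableT_comp mf measurable_fst).
  exact: (measurableT_comp mg measurable_snd).
have := integrableP _ _ _ fi => -[_ fy]; have := integrableP _ _ _ gi => -[_ gy].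
rewrite (_ : (\int[_]_x _)%E = (\int[leb]_x ((`|f x|)%:E * \int[leb]_y (`|g y|)%:E))%E); last first.
  apply: eq_integral => x _; rewrite -ge0_integralZl//; last first.
    by apply/measurable_EFinP; apply: measurableT_comp.
  by apply: eq_integral => y _; rewrite /= normrM EFinM.
rewrite ge0_integralZr//; last 2 first.
- by apply/measurable_EFinP; apply: measurableT_comp.
- by apply: integral_ge0 => x _.
by apply: lte_mul_pinfty => //; [exact: integral_ge0|rewrite ge0_fin_numE//; exact: integral_ge0].
Qed.

Lemma Rfubini_bounded f g u (M : R) :
  leb.-integrable setT (fun x => (f x)%:E) ->
  leb.-integrable setT (fun x => (g x)%:E) ->
  measurable_fun setT u -> (forall z, `|u z| <= M) ->
  \int[leb]_x (f x * \int[leb]_y (g y * u (x, y))) =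
  \int[leb]_y (g y * \int[leb]_x (f x * u (x, y))).
Proof.
move=> fi gi mu_ uM.
have := @Fubini _ _ _ _ R leb leb _ (integrable_prod_bounded fi gi mu_ uM).
have i1 x : leb.-integrable setT (fun y => (g y * u (x, y))%:E).
  apply: (integrable_mul_bounded (M := M)) => //.
  exact: (measurableT_comp mu_ (measurable_pair1 x)).
have i2 y : leb.-integrable setT (fun x => (f x * u (x, y))%:E).
  apply: (integrable_mul_bounded (M := M)) => //.
  exact: (measurableT_comp mu_ (measurable_pair2 y)).
move=> h; congr fine.
transitivity (\int[leb]_x \int[leb]_y (f x * g y * u (x, y))%:E)%E.
  apply: eq_integral => x _.
  rewrite EFinM (EFin_Rintegral (i1 x)) -integralZl//.
  by apply: eq_integral => y _; rewrite -EFinM mulrA.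
rewrite h; apply: eq_integral => y _.
rewrite EFinM (EFin_Rintegral (i2 y)) -integralZl//.
by apply: eq_integral => x _; rewrite -EFinM mulrA [g y * f x]mulrC.
Qed.

End bounded_fubini.

Section power_spectrum.
Context {R : realType}.
Notation leb := (@lebesgue_measure R).
Variable g : R -> R.
Hypothesis gi : leb.-integrable setT (fun x => (g x)%:E).

(** These are the real part of ghat and the opposite of its imaginary part, so [power_spectrum] is
    |ghat| ^ 2, kept real-valued; see [normc_fourier_real]. *)
Definition fourier_cos (xi : R) : R := \int[leb]_x (g x * cos (2 * pi * xi * x)).
Definition fourier_sin (xi : R) : R := \int[leb]_x (g x * sin (2 * pi * xi * x)).
Definition power_spectrum (xi : R) : R := fourier_cos xi ^+ 2 + fourier_sin xi ^+ 2.

Let N := \int[leb]_x `|g x|.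

Lemma power_spectrum_ge0 xi : 0 <= power_spectrum xi.
Proof. by rewrite addr_ge0 ?sqr_ge0. Qed.

Lemma continuous_scale_comp (f : R -> R) (c : R) :
  continuous f -> continuous (fun x => f (c * x)).
Proof. by move=> cf x; apply: continuous_comp; [exact: mulrl_continuous|exact: cf]. Qed.

Lemma integrable_gmul (u : R -> R) : measurable_fun setT u ->
  (forall x, `|u x| <= 1) -> leb.-integrable setT (fun x => (g x * u x)%:E).
Proof. by move=> mu_ u1; apply: (integrable_mul_bounded gi mu_ u1). Qed.

(** Dominated convergence with majorant |g|. A general bounded continuous [u] treats cosine and sine
    at once. *)
Lemma continuous_fourier (u : R -> R) : continuous u -> (forall x, `|u x| <= 1) ->
  continuous (fun xi => \int[leb]_x (g x * u (2 * pi * xi * x))).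
Proof.
move=> cu u1 xi.
have mu_ (c : R) : measurable_fun setT (fun x : R => u (c * x)).
  by apply: continuous_measurable_fun; exact: continuous_scale_comp.
have h := @continuity_under_integral R _ _ leb
  (fun xi x => g x * u (2 * pi * xi * x)) setT measurableT
  (xi - 1) (xi + 1) _ _ (fun x => `|g x|) _ _.
apply: h.
- by move=> x _; exact: integrable_gmul.
- apply: aeW => y _ x _ /=; apply: cvgM; first exact: cvg_cst.
  under eq_fun do rewrite -mulrA [_ * y]mulrC mulrA.
  rewrite -mulrA [x * y]mulrC mulrA.
  exact: (@continuous_scale_comp u).
- by have := integrable_abse gi.
- by move=> x _; apply: aeW => y _; rewrite normrM ler_piMr.
- by rewrite inE/= in_itv/=; apply/andP; split; lra.
Qed.

Lemma continuous_fourier_cos : continuous fourier_cos.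
Proof. by apply: continuous_fourier; [exact: continuous_cos|exact: cos_max]. Qed.

Lemma continuous_fourier_sin : continuous fourier_sin.
Proof. by apply: continuous_fourier; [exact: continuous_sin|exact: sin_max]. Qed.

Lemma continuous_power_spectrum : continuous power_spectrum.
Proof.
by move=> xi; apply: cvgD; apply: (@continuous_comp _ _ _ _ (fun x : R => x ^+ 2));
  [exact: continuous_fourier_cos|exact: exprn_continuous|
   exact: continuous_fourier_sin|exact: exprn_continuous].
Qed.

Lemma fourier_le (u : R -> R) : measurable_fun setT u -> (forall x, `|u x| <= 1) ->
  `|\int[leb]_x (g x * u x)| <= N.
Proof.
move=> mu_ u1; apply: (le_trans (le_normr_Rintegral _ _)) => //.
  exact: integrable_gmul.
apply: le_Rintegral => //.
- exact: (integrable_abse (integrable_gmul mu_ u1)).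
- exact: (integrable_abse gi).
- by move=> x _; rewrite normrM ler_piMr.
Qed.

Lemma fourier_cos_le xi : `|fourier_cos xi| <= N.
Proof.
apply: fourier_le => [|x]; last exact: cos_max.
by apply: continuous_measurable_fun; apply: continuous_scale_comp; exact: continuous_cos.
Qed.

Lemma fourier_sin_le xi : `|fourier_sin xi| <= N.
Proof.
apply: fourier_le => [|x]; last exact: sin_max.
by apply: continuous_measurable_fun; apply: continuous_scale_comp; exact: continuous_sin.
Qed.

End power_spectrum.

(** * The Plancherel inequality by Poisson smoothing *)

Section poisson_smoothing.
Context {R : realType}.
Notation leb := (@lebesgue_measure R).
Variable g : R -> R.
Hypothesis gi : leb.-integrable setT (fun x => (g x)%:E).
Local Notation C := (fourier_cos g).
Local Notation S := (fourier_sin g).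
Local Notation N := (\int[leb]_x `|g x|).

(** Two choices of coefficients matter below: [C xi], [S xi] produce the power spectrum, and the
    cosine and sine of 2 pi xi x produce the integral of [g y] against cos (2 pi xi (x - y)). *)
Lemma Rintegral_mul_cosD_sin xi a b :
  \int[leb]_x (g x * (a * cos (2 * pi * xi * x) + b * sin (2 * pi * xi * x))) =
  a * C xi + b * S xi.
Proof.
have mc : measurable_fun setT (fun x : R => cos (2 * pi * xi * x)).
  by apply: continuous_measurable_fun; apply: continuous_scale_comp; exact: continuous_cos.
have ms : measurable_fun setT (fun x : R => sin (2 * pi * xi * x)).
  by apply: continuous_measurable_fun; apply: continuous_scale_comp; exact: continuous_sin.
have ic := integrable_gmul gi mc (fun x => cos_max _).
have isn := integrable_gmul gi ms (fun x => sin_max _).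
have iZ (k : R) (f : R -> R) : leb.-integrable setT (fun x => (f x)%:E) ->
    leb.-integrable setT (EFin \o (fun x => k * f x)).
  by move=> fi; rewrite /comp; under eq_fun do rewrite EFinM; exact: integrableZl.
rewrite /fourier_cos /fourier_sin -!RintegralZl//.
rewrite -RintegralD//; [|exact: iZ|exact: iZ].
by apply: eq_Rintegral => x _; ring.
Qed.

Let R2 := (measurableTypeR R * measurableTypeR R)%type.

Let mprod : measurable_fun setT (fun z : R2 => 2 * pi * z.1 * z.2 : R).
Proof.
apply: measurable_funM; last exact: measurable_snd.
by apply: measurable_funM => //; exact: measurable_fst.
Qed.

(** Fubini is applied twice. Writing the spectrum as the integral of [g] against [u (xi, _)] moves
    the [xi]-integral inside that of [x]. For fixed [x], [u] is itself the integral of [g y] against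
    cos (2 pi xi (x - y)), and a second exchange leaves the cosine transform of the weight, which is
    the kernel. *)
Lemma weighted_power_spectrum e : 0 < e ->
  \int[leb]_xi (expR (- e * `|xi|) * power_spectrum g xi) =
  \int[leb]_x (g x * \int[leb]_y (g y * poisson e (x - y))).
Proof.
move=> e0.
have wi := integrable_expRNnorm e0.
have mcos : measurable_fun setT (@cos R).
  by apply: continuous_measurable_fun; exact: continuous_cos.
have msin : measurable_fun setT (@sin R).
  by apply: continuous_measurable_fun; exact: continuous_sin.
pose u (z : R2) := C z.1 * cos (2 * pi * z.1 * z.2) + S z.1 * sin (2 * pi * z.1 * z.2).
have mC : measurable_fun setT (fun z : R2 => C z.1).
  apply: (@measurableT_comp _ _ _ _ _ _ C _ fst); last exact: measurable_fst.
  apply: continuous_measurable_fun; exact: continuous_fourier_cos.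
have mS : measurable_fun setT (fun z : R2 => S z.1).
  apply: (@measurableT_comp _ _ _ _ _ _ S _ fst); last exact: measurable_fst.
  apply: continuous_measurable_fun; exact: continuous_fourier_sin.
have mu_ : measurable_fun setT u.
  apply: measurable_funD; apply: measurable_funM => //.
    exact: (measurableT_comp mcos mprod).
  exact: (measurableT_comp msin mprod).
have uM z : `|u z| <= N + N.
  apply: (le_trans (ler_normD _ _)); rewrite !normrM; apply: lerD.
    by rewrite -[leRHS]mulr1 ler_pM ?fourier_cos_le ?cos_max.
  by rewrite -[leRHS]mulr1 ler_pM ?fourier_sin_le ?sin_max.
have := Rfubini_bounded wi gi mu_ uM.
under eq_Rintegral => xi _.
  rewrite /u /= Rintegral_mul_cosD_sin -!expr2 -/(power_spectrum g xi); over.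
move=> ->; apply: eq_Rintegral => x _; congr (_ * _).
pose v (z : R2) := cos (2 * pi * z.1 * (x - z.2)).
have mv : measurable_fun setT v.
  apply: (measurableT_comp mcos); apply: measurable_funM.
    by apply: measurable_funM => //; exact: measurable_fst.
  by apply: measurable_funB => //; exact: measurable_snd.
have hv := Rfubini_bounded wi gi mv (fun z => cos_max _).
transitivity (\int[leb]_xi (expR (- e * `|xi|) * \int[leb]_y (g y * v (xi, y)))).
  apply: eq_Rintegral => xi _; congr (_ * _).
  rewrite /u/= mulrC [S xi * _]mulrC -Rintegral_mul_cosD_sin.
  by apply: eq_Rintegral => y _; rewrite /v/= mulrBr cosB.
rewrite hv; apply: eq_Rintegral => y _; congr (_ * _).
rewrite /poisson -Rintegral_expRNnorm_cos//.
by apply: eq_Rintegral => xi _; rewrite /v /= mulrAC.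
Qed.

Lemma integral_poisson_subl e x : 0 < e ->
  (\int[leb]_y (poisson e (x - y))%:E = 1)%E.
Proof.
move=> e0; rewrite -(integral_poisson e0).
apply: (@ge0_integral_reflect R x (fun y => (poisson e y)%:E)).
  apply/measurable_EFinP; apply: continuous_measurable_fun; exact: continuous_poisson.
by move=> y; rewrite lee_fin poisson_ge0.
Qed.

Lemma poisson_quadratic_form_le e : 0 < e ->
  ((\int[leb]_x (g x * \int[leb]_y (g y * poisson e (x - y))))%R%:E <=
   \int[leb]_x ((g x ^+ 2)%:E))%E.
Proof.
move=> e0.
have mg : measurable_fun setT g by have /integrableP[/measurable_EFinP] := gi.
have mg2 : measurable_fun setT (fun x => g x ^+ 2) by exact: measurable_funX.
pose u (z : R2) := poisson e (z.1 - z.2).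
have mu_ : measurable_fun setT u.
  apply: (@measurableT_comp _ _ _ _ _ _ (poisson e)).
    apply: continuous_measurable_fun; exact: continuous_poisson.
  by apply: measurable_funB; [exact: measurable_fst|exact: measurable_snd].
have u0 z : 0 <= u z by exact: poisson_ge0.
have uM z : `|u z| <= 2 / e by rewrite ger0_norm// poisson_le.
have iu x : leb.-integrable setT (fun y => (g y * u (x, y))%:E).
  apply: (integrable_mul_bounded gi) => //.
  exact: (measurableT_comp mu_ (measurable_pair1 x)).
have ip := integrable_prod_bounded gi gi mu_ uM.
have -> : (\int[leb]_x (g x * \int[leb]_y (g y * poisson e (x - y)))%R =
    fine (\int[(leb \x leb)%E]_z (g z.1 * g z.2 * u z)%:E)%E)%R.
  rewrite -(integral12_prod_meas1 ip); congr fine; apply: eq_integral => x _.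
  rewrite EFinM (EFin_Rintegral (iu x)) -integralZl//.
  by apply: eq_integral => y _; rewrite -EFinM mulrA.
rewrite fineK; last exact: integrable_fin_num.
(* The two halves of the bound 2 g x g y <= g x ^ 2 + g y ^ 2, weighted by the kernel. Each
   integrates to the integral of [g ^ 2], since the even kernel has mass 1 in either variable. *)
pose a (z : R2) := (g z.1 ^+ 2 * u z)%:E; pose b (z : R2) := (g z.2 ^+ 2 * u z)%:E.
have ma : measurable_fun setT a.
  apply/measurable_EFinP; apply: measurable_funM => //.
  exact: (measurableT_comp mg2 measurable_fst).
have mb : measurable_fun setT b.
  apply/measurable_EFinP; apply: measurable_funM => //.
  exact: (measurableT_comp mg2 measurable_snd).
have a0 z : (0 <= a z)%E by rewrite lee_fin mulr_ge0 ?sqr_ge0.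
have b0 z : (0 <= b z)%E by rewrite lee_fin mulr_ge0 ?sqr_ge0.
have Ia : (\int[(leb \x leb)%E]_z a z = \int[leb]_x (g x ^+ 2)%:E)%E.
  rewrite fubini_tonelli1//; apply: eq_integral => x _; rewrite /a /fubini_F /=.
  under eq_integral do rewrite EFinM.
  rewrite ge0_integralZl//.
  - by rewrite integral_poisson_subl// mule1.
  - apply/measurable_EFinP; exact: (measurableT_comp mu_ (measurable_pair1 x)).
  - by move=> y _; rewrite lee_fin.
  - by rewrite lee_fin sqr_ge0.
have Ib : (\int[(leb \x leb)%E]_z b z = \int[leb]_x (g x ^+ 2)%:E)%E.
  rewrite fubini_tonelli2//; apply: eq_integral => y _; rewrite /b /fubini_G /=.
  under eq_integral do rewrite EFinM.
  rewrite ge0_integralZl//.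
  - under eq_integral do rewrite /u /= -poissonN opprB.
    by rewrite integral_poisson_subl// mule1.
  - apply/measurable_EFinP; exact: (measurableT_comp mu_ (measurable_pair2 y)).
  - by move=> x _; rewrite lee_fin.
  - by rewrite lee_fin sqr_ge0.
have -> : (\int[leb]_x (g x ^+ 2)%:E = (2^-1)%:E * \int[(leb \x leb)%E]_z (a z + b z))%E.
  rewrite ge0_integralD// Ia Ib.
  set I := (\int[_]_x _)%E.
  have I0 : (0 <= I)%E by apply: integral_ge0 => x _; rewrite lee_fin sqr_ge0.
  by rewrite -mule2n -[(_ *+ 2)%E]mule_natl muleA -EFinM mulVf ?mul1e.
(* An infinite right-hand side is set apart so that [a + b] is integrable when the signed integrals
   are compared. *)
have [->|Iy] := eqVneq (\int[(leb \x leb)%E]_z (a z + b z))%E +oo%E.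
  by rewrite gt0_muley ?leey// lte_fin invr_gt0.
have iab : (leb \x leb)%E.-integrable setT (fun z => a z + b z)%E.
  apply/integrableP; split; first exact: emeasurable_funD.
  under eq_integral do rewrite gee0_abs ?adde_ge0//.
  by rewrite ltey.
rewrite -integralZl//.
apply: le_integral => //; first exact: integrableZl.
move=> z _; rewrite /a /b -EFinD -EFinM lee_fin.
have := u0 z; have := sqr_ge0 (g z.1 - g z.2).
nra.
Qed.

Lemma integral_weighted_power_spectrum_le e : 0 < e ->
  (\int[leb]_xi (expR (- e * `|xi|) * power_spectrum g xi)%:E <=
   \int[leb]_x ((g x ^+ 2)%:E))%E.
Proof.
move=> e0; rewrite -EFin_Rintegral.
  by rewrite weighted_power_spectrum// poisson_quadratic_form_le.
have N0 : 0 <= N by apply: Rintegral_ge0.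
apply: (integrable_mul_bounded (integrable_expRNnorm e0) (M := N ^+ 2 + N ^+ 2)).
  apply: continuous_measurable_fun; exact: continuous_power_spectrum.
move=> xi; rewrite ger0_norm ?power_spectrum_ge0//; apply: lerD.
  by rewrite -[C xi ^+ 2]real_normK ?num_real// lerXn2r ?nnegrE ?fourier_cos_le.
by rewrite -[S xi ^+ 2]real_normK ?num_real// lerXn2r ?nnegrE ?fourier_sin_le.
Qed.

End poisson_smoothing.

Section window.
Context {R : realType}.
Notation leb := (@lebesgue_measure R).
Variable g : R -> R.
Hypothesis gi : leb.-integrable setT (fun x => (g x)%:E).

(** On a bounded window |s - t| is at most some [r], so the weight exp (- e |s - t|) is at least exp
    (- e r). The weighted bound thus holds without the weight up to the factor exp (e r), and [e] is
    then taken small. *)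
Lemma integral_window_power_spectrum_le (s a b : R) :
  (\int[leb]_(t in `[a, b]) (power_spectrum g (s - t))%:E <=
   \int[leb]_x ((g x ^+ 2)%:E))%E.
Proof.
set I := (\int[leb]_x _)%E.
have I0 : (0 <= I)%E by apply: integral_ge0 => x _; rewrite lee_fin sqr_ge0.
set X := integral _ _ _.
have X0 : (0 <= X)%E by apply: integral_ge0 => x _; rewrite lee_fin power_spectrum_ge0.
have [->|Iy] := eqVneq I +oo%E; first exact: leey.
have Ifin : I \is a fin_num by rewrite ge0_fin_numE// ltey.
pose r := `|s| + `|a| + `|b|.
have cs (f : R -> R) : continuous f -> continuous (fun t => f (s - t)).
  move=> cf t; apply: (@continuous_comp _ _ _ (fun t => s - t) f); last exact: cf.
  by apply: cvgB; [exact: cvg_cst|exact: cvg_id].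
have ch : continuous (power_spectrum g) by exact: continuous_power_spectrum.
have XI (e : R) : 0 < e -> (X <= (expR (e * r))%:E * I)%E.
  move=> e0.
  pose W t := expR (- e * `|t|) * power_spectrum g t.
  have W0 t : 0 <= W t by rewrite mulr_ge0 ?expR_ge0 ?power_spectrum_ge0.
  have cW : continuous W.
    by move=> t; apply: cvgM; [exact: continuous_expRNnorm|exact: ch].
  have mW : measurable_fun setT W by exact: continuous_measurable_fun.
  have mWs : measurable_fun setT (fun t : R => (W (s - t))%:E).
    by apply/measurable_EFinP; apply: continuous_measurable_fun; exact: cs.
  apply: (@le_trans _ _ ((expR (e * r))%:E * \int[leb]_t (W (s - t))%:E)%E); last first.
    rewrite (@ge0_integral_reflect R s (fun t => (W t)%:E)).
    - by rewrite lee_wpmul2l ?lee_fin ?expR_ge0// integral_weighted_power_spectrum_le.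
    - exact/measurable_EFinP.
    - by move=> t; rewrite lee_fin.
  rewrite -ge0_integralZl//; last by move=> t _; rewrite lee_fin.
  apply: (@le_trans _ _
    (\int[leb]_(t in `[a, b]) ((expR (e * r))%:E * (W (s - t))%:E))%E); last first.
    apply: ge0_subset_integral => //.
      by apply: emeasurable_funM.
    by move=> t _; rewrite -EFinM lee_fin mulr_ge0 ?expR_ge0.
  apply: ge0_le_integral => //.
  - by move=> t _; rewrite lee_fin power_spectrum_ge0.
  - apply/measurable_EFinP; apply: measurable_funTS; apply: continuous_measurable_fun; exact: cs.
  - by apply: measurable_funTS; apply: emeasurable_funM.
  move=> t; rewrite /= in_itv/= => /andP[at_ tb]; rewrite -EFinM lee_fin /W mulrA -expRD.
  rewrite -[leLHS]mul1r ler_wpM2r ?power_spectrum_ge0//.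
  rewrite -[leLHS]expR0 ler_expR mulNr -mulrBr mulr_ge0 ?(ltW e0)// subr_ge0.
  rewrite (le_trans (ler_normB _ _))// /r -addrA lerD2l.
  rewrite ler_norml; apply/andP; split.
    by have := ler_norm (- a); rewrite normrN; have := normr_ge0 b; lra.
  by have := ler_norm b; have := normr_ge0 a; lra.
have Xfin : X \is a fin_num.
  rewrite ge0_fin_numE//; apply: (le_lt_trans (XI 1 ltr01)).
  by rewrite -(fineK Ifin) -EFinM ltry.
rewrite -(fineK Xfin) -(fineK Ifin) lee_fin.
set x := fine X; set i := fine I.
have x0 : 0 <= x by exact: fine_ge0.
have r0 : 0 <= r by rewrite !addr_ge0.
apply/ler_addgt0Pr => d d0.
(* Chosen so that [e * r * x <= d]; with exp (- e r) >= 1 - e r this gives [x <= i + d]. The added 1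
   keeps the denominator positive. *)
pose e := d / (r * x + 1).
have rx0 : 0 <= r * x by exact: mulr_ge0.
have rx1 : 0 < r * x + 1 by lra.
have e0 : 0 < e by rewrite divr_gt0.
have : x <= expR (e * r) * i.
  by rewrite -lee_fin EFinM /x /i !fineK//; exact: XI.
have Ep : 0 < expR (e * r) by exact: expR_gt0.
rewrite -ler_pdivrMl// -expRN => h.
have h1 := expR_ge1Dx (- (e * r)).
have h2 : (1 + - (e * r)) * x <= expR (- (e * r)) * x by exact: ler_wpM2r.
have h3 : e * (r * x) <= d.
  rewrite /e mulrAC ler_pdivrMr//; apply: ler_wpM2l; [exact: ltW|lra].
by have := le_trans h2 h; lra.
Qed.

End window.

(** * Sums over separated sequences *)

Section esum_int.
Context {R : realType}.

(** Every finite set of integers lies in some symmetric interval [- N, N], and [N] may be enlarged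
    beyond [N0]. *)
Lemma esum_int_le (a : int -> \bar R) (N0 : nat) (B : \bar R) :
  (forall k, 0 <= a k)%E ->
  (forall N : nat, (N0 <= N)%N ->
     \sum_(0 <= i < (2 * N).+1) a (i%:Z - N%:Z)%R <= B)%E ->
  (\esum_(k in [set: int]) a k <= B)%E.
Proof.
move=> a0 aB; apply: ge_ereal_sup => _ [X [Xfin _] <-].
have [r Xr] := (finite_seqP X).1 Xfin.
pose N := (N0 + \max_(k <- r) absz k)%N.
pose s := [seq (i%:Z - N%:Z) | i <- index_iota 0 (2 * N).+1].
have us : uniq s.
  rewrite map_inj_uniq ?iota_uniq// => i j /eqP.
  by rewrite (inj_eq (addIr _)) => /eqP [].
apply: (@le_trans _ _ (\sum_(k \in [set` s]) a k)%E).
  apply: lee_fsum_nneg_subset => //; first exact: finite_seq.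
  move=> k; rewrite !inE => Xk /=.
  have kN : (absz k <= N)%N.
    rewrite /N; apply: leq_trans (leq_addl _ _).
    by apply: leq_bigmax_seq; first by move: Xk; rewrite Xr.
  apply/mapP; exists (absz (k + N%:Z)); first by rewrite mem_index_iota; lia.
  by lia.
rewrite -fsbig_seq// big_map; apply: aB; exact: leq_addr.
Qed.

(** The indices from - (q + r) to n + q - 1 are kept; the tail on each side telescopes to at most
    [b q]. The shift [r] on the left leaves room for the steps with small gaps. *)
Lemma esum_telescoping_tails (a : int -> R) (b : nat -> R) (n q r : nat) :
  (forall k, 0 <= a k) -> (forall j, 0 <= b j) ->
  (forall j : nat, (q <= j)%N -> a (n%:Z + j%:Z) <= b j - b j.+1) ->
  (forall j : nat, (q <= j)%N -> a (- (j + r)%:Z) <= b j - b j.+1) ->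
  (\esum_(k in [set: int]) (a k)%:E <=
    (\sum_(0 <= i < n + (2 * q + r)) a (i%:Z - (q + r)%:Z) + b q *+ 2)%R%:E)%E.
Proof.
move=> a0 b0 au al; apply: (@esum_int_le _ (n + q + r)%N).
  by move=> k; rewrite lee_fin.
move=> N hN; rewrite sumEFin lee_fin.
rewrite (@big_cat_nat _ _ _ (N - (q + r))%N)/=; [|lia|lia].
rewrite (@big_cat_nat _ _ _ (N + n + q)%N (N - (q + r))%N)/=; [|lia|lia].
rewrite addrCA lerD//.
  have -> : (N - (q + r) = 0 + (N - (q + r)))%N by lia.
  rewrite big_addn.
  have -> : (N + n + q - (0 + (N - (q + r))) = n + (2 * q + r))%N by lia.
  rewrite le_eqVlt; apply/orP; left; apply/eqP; apply: eq_bigr => i _; congr a; lia.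
rewrite mulr2n; apply: lerD.
  (* The left tail is summed from its far end inwards, so the telescoping runs through [b]
     backwards. *)
  pose f i := b (N - i - r).+1.
  apply: (@le_trans _ _ (\sum_(0 <= i < N - (q + r)) (f i.+1 - f i))).
    apply: ler_sum_nat => i /andP[_ iN].
    have -> : i%:Z - N%:Z = - (N - i - r + r)%:Z by lia.
    have -> : f i.+1 = b (N - i - r)%N by rewrite /f; congr b; lia.
    by apply: al; lia.
  rewrite telescope_sumr// /f.
  (* The telescoped sum stops at [b q.+1], because the index - (q + r) is in the kept block; the
     hypothesis at [j = q] gives [b q.+1 <= b q]. *)
  have := b0 (N - 0 - r).+1.
  have -> : (N - (N - (q + r)) - r = q)%N by lia.
  have := al q (leqnn _); have := a0 (- (q + r)%:Z); lra.
pose f i := - b (i - N - n)%N.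
apply: (@le_trans _ _ (\sum_(N + n + q <= i < (2 * N).+1) (f i.+1 - f i))).
  apply: ler_sum_nat => i /andP[iN _].
  have -> : i%:Z - N%:Z = n%:Z + (i - N - n)%:Z by lia.
  have -> : f i.+1 = - b (i - N - n).+1 by rewrite /f; congr (- b _); lia.
  by rewrite /f opprK [leRHS]addrC; apply: au; lia.
rewrite telescope_sumr; last lia.
rewrite /f opprK.
have -> : (N + n + q - N - n = q)%N by lia.
by have := b0 ((2 * N).+1 - N - n)%N; lra.
Qed.

End esum_int.

Section separated.
Context {R : realType}.
Notation leb := (@lebesgue_measure R).
Variables (lam : int -> R) (c : R) (K : nat).
Hypothesis lam_incr : {homo lam : m n / m < n}.
Hypothesis gap : forall k : int, (K <= absz k)%N -> c <= spectral_gap lam k.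
(** With the origin moved to [K], every gap to the right of [u 0] is at least [c]. *)
Let u (k : int) := lam (K%:Z + k).

Lemma gap_right (i j : nat) : u i%:Z + j%:R * c <= u (i%:Z + j%:Z).
Proof.
elim: j => [|j ih]; first by rewrite mul0r !addr0.
have : c <= spectral_gap lam (K%:Z + (i%:Z + j.+1%:Z)) by apply: gap; lia.
rewrite /spectral_gap.
have -> : K%:Z + (i%:Z + j.+1%:Z) - 1 = K%:Z + (i%:Z + j%:Z) by lia.
by move: ih; rewrite /u -natr1; lra.
Qed.

(* The small gaps all lie between the indices [-K] and [K]; discarding these [2 K]
   steps costs nothing since [lam] is increasing. *)
Lemma gap_left (j : nat) : u (- (j + 2 * K)%:Z) + j%:R * c <= u 0.
Proof.
elim: j => [|j ih].
  rewrite mul0r addr0 /u; have [->|K0] := eqVneq K 0%N; first by rewrite muln0 oppr0.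
  by apply: ltW; apply: lam_incr; lia.
have : c <= spectral_gap lam (- (j + K)%:Z) by apply: gap; lia.
rewrite /spectral_gap.
move: ih; rewrite /u -natr1.
have -> : K%:Z - (j + 2 * K)%:Z = - (j + K)%:Z by lia.
have -> : K%:Z - (j.+1 + 2 * K)%:Z = - (j + K)%:Z - 1 by lia.
by lra.
Qed.

(** The averaging argument, by contradiction: if [A * c > H], one can fix [q] with tails so small
    that [A' * c > H] still holds. The estimate [key] then compares two linear functions of [n] with
    slopes [A' * c] and [H], and fails for large [n]. *)
Lemma frame_density_le (h : R -> R) (b : nat -> R) (q0 : nat) (A H : R) :
  0 < c -> (forall x, 0 <= h x) -> continuous h ->
  (forall s x y : R, (\int[leb]_(t in `[x, y]) (h (s - t))%:E <= H%:E)%E) ->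
  (forall j, 0 <= b j) ->
  (forall d, 0 < d -> exists2 q, (q0 <= q)%N & b q <= d) ->
  (forall j : nat, (q0 <= j)%N -> forall x, j%:R * c <= `|x| -> h x <= b j - b j.+1) ->
  (forall t, (A%:E <= \esum_(k in [set: int]) (h (lam k - t))%:E)%E) ->
  A * c <= H.
Proof.
move=> c0 h0 ch hH b0 bcvg hb frame.
rewrite leNgt; apply/negP => HAc.
have H0 : 0 <= H.
  rewrite -lee_fin; apply: le_trans (hH 0 0 0).
  by apply: integral_ge0 => t _; rewrite lee_fin.
(* Then [d * c] is a quarter of [A * c - H], so the two tails together use up at most half of this
   excess. *)
pose d := (A * c - H) / (4 * c).
have d0 : 0 < d by rewrite divr_gt0 ?subr_gt0// mulr_gt0.
have [q q0q bq] := bcvg d d0.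
pose A' := A - b q *+ 2.
have A'c : H < A' * c.
  have : b q * c <= (A * c - H) / 4.
    apply: (@le_trans _ _ (d * c)); first by rewrite ler_pM2r.
    by rewrite /d invfM mulrA mulfVK// gt_eqF.
  by rewrite /A' mulr2n; lra.
have A'0 : 0 <= A' by rewrite -(pmulr_lge0 _ c0) (le_trans H0)// ltW.
have key (n : nat) : A' * (n%:R * c) <= (n + (2 * q + 2 * K))%:R * H.
  have un : u 0 + n%:R * c <= u n%:Z by have := gap_right 0 n; rewrite add0r.
  pose L := u n%:Z - u 0.
  have L0 : 0 <= L by rewrite subr_ge0 (le_trans _ un)// lerDl mulr_ge0// ltW.
  apply: (@le_trans _ _ (A' * L)).
    by rewrite ler_wpM2l// lerBrDl.
  pose m := (n + (2 * q + 2 * K))%N.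
  (* For [t] in the window, the points [u (n + j)] and [u (- (j + 2 * K))] are at distance at least
     [j * c] from [t], so all but [m] terms of the frame sum fall under the majorant [b]. *)
  have ptw t : u 0 <= t <= u n%:Z ->
      A' <= \sum_(0 <= i < m) h (u (i%:Z - (q + 2 * K)%:Z) - t).
    move=> /andP[t1 t2]; rewrite lerBlDr -lee_fin.
    apply: le_trans (frame t) _.
    rewrite (@reindex_esum R _ _ [set: int] [set: int] (fun k => K%:Z + k)); last first.
      rewrite setTT_bijective; exists (fun k => k - K%:Z) => k; lia.
    apply: (@esum_telescoping_tails _ (fun k => h (u k - t)) b n q (2 * K)%N) => //.
      move=> j qj; apply: hb; first exact: leq_trans q0q qj.
      have hj := gap_right n j; rewrite ger0_norm; first by lra.
      by have : 0 <= j%:R * c by [rewrite mulr_ge0// ltW]; lra.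
    move=> j qj; apply: hb; first exact: leq_trans q0q qj.
    have hj := gap_left j; rewrite distrC ger0_norm; first by lra.
    by have : 0 <= j%:R * c by [rewrite mulr_ge0// ltW]; lra.
  have chs s : continuous (fun t => h (s - t)).
    move=> t; apply: (@continuous_comp _ _ _ (fun t => s - t) h); last exact: ch.
    by apply: cvgB; [exact: cvg_cst|exact: cvg_id].
  rewrite -lee_fin.
  have -> : ((A' * L)%:E = \int[leb]_(t in `[u 0%R, u n%:Z]) (A'%:E))%E.
    rewrite integral_cst//= lebesgue_measure_itv/= lte_fin EFinM; congr (_ * _)%E.
    by case: ltP => // h1; congr EFin; apply/eqP; rewrite eq_le L0 /L subr_le0 h1.
  apply: (@le_trans _ _ (\int[leb]_(t in `[u 0%R, u n%:Z])
      (\sum_(0 <= i < m) (h (u (i%:Z - (q + 2 * K)%:Z) - t)%R)%:E))%E).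
    apply: ge0_le_integral => //.
      apply: emeasurable_sum => i; apply/measurable_EFinP; apply: measurable_funTS.
      by apply: continuous_measurable_fun; exact: chs.
    by move=> t; rewrite /= in_itv/= => ht; rewrite sumEFin lee_fin ptw.
  rewrite ge0_integral_sum//; last 2 first.
  - move=> i; apply/measurable_EFinP; apply: measurable_funTS.
    by apply: continuous_measurable_fun; exact: chs.
  - by move=> i t _; rewrite lee_fin.
  apply: (@le_trans _ _ (\sum_(0 <= i < m) H%:E)%E).
    by apply: lee_sum => i _; exact: hH.
  by rewrite sumEFin lee_fin big_const_nat subn0 iter_addr_0 mulr_natl.
pose e := A' * c - H.
have e0 : 0 < e by rewrite subr_gt0.
(* The constant term of [key]; any [n] above [M / e] contradicts it. *)
pose M := (2 * q + 2 * K)%:R * H.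
have M0 : 0 <= M / e by rewrite divr_ge0 ?mulr_ge0// ltW.
have := archi_boundP M0; set n := Num.bound _.
rewrite ltr_pdivrMr// => hn; have := key n; rewrite natrD [leRHS]mulrDl -/M.
by move: hn; rewrite /e; lra.
Qed.

End separated.

(** * Telescoping majorants for power decay *)

Section decay.
Context {R : realType}.

(** A discrete integral comparison. Dividing by j ^ (- d) leaves d / j <= w ^ (- d) - 1 with w = 1 -
    1 / j, which follows from exp y >= 1 + y and ln w <= - 1 / j. *)
Lemma powR_telescope (d : R) (j : nat) : 0 < d -> (1 < j)%N ->
  d * j%:R `^ (- (1 + d)) <= j.-1%:R `^ (- d) - j%:R `^ (- d).
Proof.
move=> d0 j1.
have j0 : 0 < j%:R :> R by rewrite ltr0n; lia.
pose w : R := 1 - j%:R^-1.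
have jw : j.-1%:R = j%:R * w.
  by by rewrite mulrBr mulr1 divff ?gt_eqF// -subn1 natrB//; lia.
have w0 : 0 < w.
  by rewrite subr_gt0 invf_lt1// ltr1n.
rewrite jw powRM ?(ltW j0) ?(ltW w0)// -[X in _ - X]mulr1 -mulrBr opprD addrC.
rewrite powRD; last by rewrite (gt_eqF j0) implybT.
rewrite powR_inv1 ?(ltW j0)// mulrCA ler_wpM2l ?powR_ge0//.
rewrite lerBrDl.
apply: (@le_trans _ _ (1 + - d * ln w)).
  have := @le_ln1Dx R (- j%:R^-1); rewrite ltrN2 invf_lt1// ltr1n => /(_ j1) hl.
  rewrite lerD2l mulNr -mulrN ler_wpM2l ?(ltW d0)//.
  by rewrite lerNr.
by rewrite /powR (gt_eqF w0) expR_ge1Dx.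
Qed.

(** The exponent 2 al = 1 + d exceeds 1, so [powR_telescope] applies: [D] makes C ^ 2 (j c) ^ (- (1
    + d)) equal to D d j ^ (- (1 + d)), which the difference of consecutive values of [b]
    dominates. *)
Lemma decay_majorant (h : R -> R) (C M al c : R) :
  2^-1 < al -> 0 < c ->
  (forall x, M <= `|x| -> h x <= (C * `|x| `^ (- al)) ^+ 2) ->
  exists (b : nat -> R) (q0 : nat),
    [/\ forall j, 0 <= b j,
        forall d, 0 < d -> exists2 q, (q0 <= q)%N & b q <= d &
        forall j : nat, (q0 <= j)%N -> forall x, j%:R * c <= `|x| -> h x <= b j - b j.+1].
Proof.
move=> al2 c0 hdec.
pose d := 2 * al - 1; have d0 : 0 < d by rewrite /d; lra.
pose D := C ^+ 2 * c `^ (- (1 + d)) / d.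
have D0 : 0 <= D.
  by apply: divr_ge0; [rewrite mulr_ge0 ?sqr_ge0 ?powR_ge0|exact: ltW].
(* The 2 ensures [1 < j] for [powR_telescope]; the second summand ensures [M <= j * c], where the
   decay hypothesis applies. *)
pose q0 := (2 + Num.bound `|M / c|)%N.
exists (fun j => D * j.-1%:R `^ (- d)), q0; split.
- by move=> j; rewrite mulr_ge0// powR_ge0.
- move=> e e0.
  (* Solves [e * y ^ d = D + 1], so [q.-1 >= y] makes the majorant at [q] at most [e]. *)
  pose y := ((D + 1) / e) `^ d^-1.
  have De : 0 < (D + 1) / e by rewrite divr_gt0// ltr_wpDl.
  have y0 : 0 < y by exact: powR_gt0.
  pose q := (q0 + Num.bound y).+1.
  exists q; first by rewrite /q; lia.
  have yq : y <= q.-1%:R.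
    rewrite /= natrD; have := archi_boundP (ltW y0); have := ler0n R q0; lra.
  have q1 : 0 < q.-1%:R :> R by exact: lt_le_trans yq.
  rewrite powRN ler_pdivrMr ?powR_gt0//.
  apply: (@le_trans _ _ (e * y `^ d)); last first.
    by rewrite ler_wpM2l ?(ltW e0)//; apply: ge0_ler_powR; rewrite // ?nnegrE ltW.
  rewrite /y -powRrM mulVf ?gt_eqF// powRr1 ?(ltW De)// [leRHS]mulrC divfK ?gt_eqF//.
  by rewrite lerDl.
- move=> j qj x jx.
  have j2 : (1 < j)%N by rewrite /q0 in qj; lia.
  have j0 : 0 < j%:R :> R by rewrite ltr0n; lia.
  have x0 : 0 < `|x| by apply: lt_le_trans jx; exact: mulr_gt0.
  have Mx : M <= `|x|.
    apply: le_trans jx; rewrite -ler_pdivrMr//.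
    apply: (le_trans (ler_norm _)); apply: (le_trans (ltW (archi_boundP (normr_ge0 _)))).
    by rewrite ler_nat; apply: leq_trans qj; exact: leq_addl.
  apply: (le_trans (hdec x Mx)); rewrite exprMn.
  have -> : (`|x| `^ (- al)) ^+ 2 = `|x| `^ (- (1 + d)).
    rewrite expr2 -powRD; last by rewrite (gt_eqF x0) implybT.
    by congr (_ `^ _); rewrite /d; lra.
  apply: (@le_trans _ _ (C ^+ 2 * (j%:R * c) `^ (- (1 + d)))).
    rewrite ler_wpM2l ?sqr_ge0// !powRN lef_pV2 ?posrE ?powR_gt0 ?mulr_gt0//.
    apply: ge0_ler_powR => //; last by rewrite nnegrE mulr_ge0// ltW.
    by have := d0; lra.
  rewrite powRM ?(ltW j0) ?(ltW c0)// -mulrBr.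
  apply: le_trans (ler_wpM2l D0 (powR_telescope d0 j2)).
  by rewrite /D !mulrA divfK ?gt_eqF// mulrAC.
Qed.

End decay.

Local Open Scope complex_scope.

(** * Densities and complex Fourier transforms *)

Section density.
Context {R : realType}.
Notation leb := (@lebesgue_measure R).
Variables (mu : probability (measurableTypeR R) R) (g : R -> R).
Hypothesis gi : leb.-integrable setT (fun x => (g x)%:E).
Hypothesis mug : forall E : set (measurableTypeR R), measurable E ->
  (mu E = \int[leb]_(x in E) (g x)%:E)%E.

(** [g] equals the Radon-Nikodym derivative of [mu] almost everywhere, both having integral [mu E]
    over each measurable [E]; the change of variables for the derivative then carries over to
    [g]. *)
Lemma Rintegral_density (u : R -> R) : measurable_fun setT u ->
  (forall x, `|u x| <= 1) -> \int[mu]_x u x = \int[leb]_x (g x * u x).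
Proof.
move=> mu_ u1.
have mg : measurable_fun setT (fun x => (g x)%:E) by exact: (measurable_int leb).
have dom : mu `<< leb.
  apply/null_content_dominatesP => E mE E0.
  by rewrite mug// null_set_integral//; exact: measurable_funTS.
have iu : mu.-integrable setT (fun x => (u x)%:E).
  have i1 : mu.-integrable setT (fun=> (1 : R)%:E).
    by apply: finite_measure_integrable_cst.
  have := integrable_mul_bounded i1 mu_ u1.
  by apply: eq_integrable => // x _; rewrite mul1r.
congr fine.
rewrite -(Radon_Nikodym_change_of_variables dom measurableT iu).
apply: ae_eq_integral => //.
- apply: emeasurable_funM; first exact/measurable_EFinP.
  by apply: (measurable_int leb); exact: Radon_Nikodym_integrable.
- by apply/measurable_EFinP/measurable_funM => //; exact/measurable_EFinP.
have ae : ae_eq leb setT (Radon_Nikodym (charge_of_finite_measure mu) leb) (fun x => (g x)%:E).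
  apply: integral_ae_eq => //; first exact: Radon_Nikodym_integrable.
  by move=> E _ mE; rewrite -Radon_Nikodym_integral// -mug.
by apply: filterS ae => x /= h _; rewrite h// -EFinM mulrC.
Qed.

End density.

Section complex_fourier.
Context {R : realType}.
Notation leb := (@lebesgue_measure R).

Lemma normc_sqr (a b : R) : Normc.normc (a +i* b) ^+ 2 = a ^+ 2 + b ^+ 2.
Proof. by rewrite /Normc.normc sqr_sqrtr// addr_ge0 ?sqr_ge0. Qed.

Lemma normc_expi_sqr (t : R) : Normc.normc (expi t) ^+ 2 = 1.
Proof. by rewrite /expi normc_sqr cos2Dsin2. Qed.

Lemma normc_fourier_real (g : R -> R) (xi : R) :
  leb.-integrable setT (fun x => (g x)%:E) ->
  Normc.normc (fourier leb (fun x => (g x)%:C) xi) ^+ 2 = power_spectrum g xi.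
Proof.
move=> gi; rewrite /fourier /cintegral normc_sqr /power_spectrum; congr (_ ^+ 2 + _).
  by apply: eq_Rintegral => x _ /=; rewrite cosN mul0r subr0.
have -> : \int[leb]_x complex.Im ((g x)%:C * expi (- (2 * pi * xi * x))) =
    \int[leb]_x (-1 * (g x * sin (2 * pi * xi * x))).
  by apply: eq_Rintegral => x _ /=; rewrite sinN mul0r addr0 mulrN mulN1r.
rewrite RintegralZl//; first by rewrite mulN1r sqrrN.
apply: integrable_gmul => // [|x]; last exact: sin_max.
by apply: continuous_measurable_fun; apply: continuous_scale_comp; exact: continuous_sin.
Qed.

(** Modulation by frequency [t] translates the transform, giving ghat (l - t). *)
Lemma normc_fourier_expi (mu : probability (measurableTypeR R) R) (g : R -> R) (t l : R) :
  leb.-integrable setT (fun x => (g x)%:E) ->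
  (forall E : set (measurableTypeR R), measurable E ->
    (mu E = \int[leb]_(x in E) (g x)%:E)%E) ->
  Normc.normc (fourier mu (fun x => expi (2 * pi * t * x)) l) ^+ 2 =
    power_spectrum g (l - t).
Proof.
move=> gi mug; rewrite /fourier /cintegral normc_sqr /power_spectrum.
have mc : measurable_fun setT (fun x : R => cos (2 * pi * (l - t) * x)).
  by apply: continuous_measurable_fun; apply: continuous_scale_comp; exact: continuous_cos.
have ms : measurable_fun setT (fun x : R => sin (2 * pi * (l - t) * x)).
  by apply: continuous_measurable_fun; apply: continuous_scale_comp; exact: continuous_sin.
congr (_ ^+ 2 + _).
  rewrite /fourier_cos -(Rintegral_density gi mug)//; last by move=> x; exact: cos_max.
  apply: eq_Rintegral => x _ /=; rewrite -cosD -[RHS]cosN; congr cos; ring.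
rewrite -sqrrN /fourier_sin -(Rintegral_density gi mug)//; last by move=> x; exact: sin_max.
have -> : \int[mu]_x complex.Im (expi (2 * pi * t * x) * expi (- (2 * pi * l * x))) =
    \int[mu]_x (-1 * sin (2 * pi * (l - t) * x)).
  apply: eq_Rintegral => x _ /=.
  by rewrite mulN1r -sinN addrC -sinD; congr sin; ring.
rewrite RintegralZl//; first by rewrite mulN1r opprK.
have i1 : mu.-integrable setT (fun=> (1 : R)%:E).
  by apply: finite_measure_integrable_cst.
have := integrable_mul_bounded i1 ms (fun x => sin_max _).
by apply: eq_integrable => // x _; rewrite mul1r.
Qed.

End complex_fourier.

(** * The bound for a fixed frame constant and the upper limit *)

Lemma finite_gaps_outside (R : realType) (lam : int -> R) (c : R) :
  0 <= c -> (c%:E < gmin lam)%E ->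
  exists K : nat, forall k : int, (K <= absz k)%N -> c <= spectral_gap lam k.
Proof.
move=> c0 cg.
have Sfin : finite_set [set k | spectral_gap lam k < c].
  (* Infinitely many gaps below [c] would put [c] in the set whose infimum is [gmin lam]. *)
  apply: contrapT => Sinf; move: cg; rewrite ltNge => /negP; apply.
  by apply: ereal_inf_lbound; exists c.
have [r Sr] := (finite_seqP _).1 Sfin.
exists (\max_(k <- r) absz k).+1 => k hk; rewrite leNgt; apply/negP => kc.
have : k \in r by have : [set k | spectral_gap lam k < c] k by []; rewrite Sr.
move=> kr; have := @leq_bigmax_seq _ r xpredT absz k kr isT.
by rewrite leqNgt hk.
Qed.

Lemma frame_bound_gap_le (R : realType) (mu : probability (measurableTypeR R) R)
  (g : R -> R) (alpha : R) (lam : int -> R) (A c : R) :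
  (@lebesgue_measure R).-integrable setT (fun x => (g x)%:E) ->
  (forall E : set (measurableTypeR R), measurable E ->
     mu E = \int[@lebesgue_measure R]_(x in E) (g x)%:E)%E ->
  2^-1 < alpha ->
  (exists C M : R, forall xi : R, M <= `|xi| ->
     Normc.normc (fourier (@lebesgue_measure R) (fun x => (g x)%:C) xi)
       <= C * `|xi| `^ (- alpha)) ->
  {homo lam : m n / m < n} ->
  (forall f : R -> R[i], complex_L2 mu f ->
     (A%:E * \int[mu]_x (Normc.normc (f x) ^+ 2)%:E
       <= \esum_(l in range lam) (Normc.normc (fourier mu f l) ^+ 2)%:E)%E) ->
  0 < c -> (c%:E < gmin lam)%E ->
  ((A * c)%:E <= \int[@lebesgue_measure R]_x (g x ^+ 2)%:E)%E.
Proof.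
move=> gi mug al2 [C [M dec]] incr frame c0 cg.
set I := (\int[_]_x _)%E.
have I0 : (0 <= I)%E by apply: integral_ge0 => x _; rewrite lee_fin sqr_ge0.
have [->|Iy] := eqVneq I +oo%E; first exact: leey.
have Ifin : I \is a fin_num by rewrite ge0_fin_numE// ltey.
have [K gap] := finite_gaps_outside (ltW c0) cg.
have hdec x : M <= `|x| -> power_spectrum g x <= (C * `|x| `^ (- alpha)) ^+ 2.
  move=> Mx; rewrite -normc_fourier_real//.
  have n0 : 0 <= Normc.normc (fourier lebesgue_measure (fun x => (g x)%:C) x).
    by rewrite /Normc.normc; case: (fourier _ _ _) => a b; exact: sqrtr_ge0.
  by rewrite lerXn2r ?nnegrE ?dec// (le_trans n0)// dec.
have [b [q0 [b0 bcvg hb]]] := decay_majorant al2 c0 hdec.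
rewrite -(fineK Ifin) lee_fin.
apply: (@frame_density_le R lam c K incr gap (power_spectrum g) b q0) => //.
- exact: power_spectrum_ge0.
- exact: continuous_power_spectrum.
- by move=> s x y; rewrite fineK//; exact: integral_window_power_spectrum_le.
move=> t.
have n1 x : Normc.normc (expi (2 * pi * t * x)) ^+ 2 = 1 by exact: normc_expi_sqr.
have I1 : (\int[mu]_x (Normc.normc (expi (2 * pi * t * x)) ^+ 2)%:E = 1)%E.
  under eq_integral do rewrite n1.
  by rewrite integral_cst// mul1e; exact: probability_setT.
have := frame (fun x => expi (2 * pi * t * x)); rewrite I1 mule1.
have -> : (\esum_(l in range lam)
     (Normc.normc (fourier mu (fun x => expi (2 * pi * t * x)) l) ^+ 2)%:E
   = \esum_(k in [set: int]) (power_spectrum g (lam k - t))%:E)%E.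
  (* The frame sum runs over the set of points; strict monotonicity makes the enumeration injective,
     so it becomes a sum over indices. *)
  rewrite (@reindex_esum R _ _ [set: int] (range lam) lam).
    by apply: eq_esum => k _; rewrite (normc_fourier_expi _ _ gi mug).
  apply: inj_bij; move=> k l _ _ kl.
  by case: (ltgtP k l) => // /incr; rewrite kl ltxx.
apply; split.
- apply: continuous_measurable_fun; apply: continuous_scale_comp; exact: continuous_cos.
- apply: continuous_measurable_fun; apply: continuous_scale_comp; exact: continuous_sin.
- by rewrite I1 ltry.
Qed.

Unset Implicit Arguments.
Set Strict Implicit.

Theorem theorem1p3 (R : realType) (mu : probability (measurableTypeR R) R)
  (g : R -> R) (alpha : R) (lam : R -> int -> R) :
  (@lebesgue_measure R).-integrable setT (EFin \o g) ->
  (forall E : set (measurableTypeR R), measurable E ->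
     mu E = \int[@lebesgue_measure R]_(x in E) (g x)%:E)%E ->
  2^-1 < alpha ->
  (exists C M : R, forall xi : R, M <= `|xi| ->
     Normc.normc (fourier (@lebesgue_measure R) (fun x => (g x)%:C) xi)
       <= C * `|xi| `^ (- alpha)) ->
  (forall A : R, 0 < A -> {homo lam A : m n / m < n}) ->
  (forall A : R, 0 < A -> forall f : R -> R[i], complex_L2 mu f ->
     (A%:E * \int[mu]_x (Normc.normc (f x) ^+ 2)%:E
       <= \esum_(l in range (lam A)) (Normc.normc (fourier mu f l) ^+ 2)%:E)%E) ->
  (limf_esup (fun A : R => A%:E * gmin (lam A))%E +oo%R
     <= \int[@lebesgue_measure R]_x (`|g x| ^+ 2)%:E)%E.
Proof.
move=> gi mug al2 dec incr frame.
under eq_integral do rewrite real_normK ?num_real//.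
set I := (\int[_]_x _)%E.
have I0 : (0 <= I)%E by apply: integral_ge0 => x _; rewrite lee_fin sqr_ge0.
have [->|Iy] := eqVneq I +oo%E; first exact: leey.
have Ifin : I \is a fin_num by rewrite ge0_fin_numE// ltey.
have i0 : 0 <= fine I by exact: fine_ge0.
(* The positive half-line is a neighbourhood of [+oo], so the supremum over [A > 0] bounds the upper
   limit. *)
apply: (@le_trans _ _ (ereal_sup [set (A%:E * gmin (lam A))%E | A in [set A : R | 0 < A]])).
  apply: ereal_inf_lbound; exists [set A : R | 0 < A] => //.
  by exists 0; split => // x x0.
apply: ge_ereal_sup => _ [A /= A0 <-].
have key c : 0 < c -> (c%:E < gmin (lam A))%E -> A * c <= fine I.
  move=> c0 cg; rewrite -lee_fin fineK//.
  exact: (@frame_bound_gap_le R mu g alpha (lam A) A c gi mug al2 dec (incr A A0) (frame A A0)).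
rewrite -(fineK Ifin).
(* This [c] violates the conclusion of [key], which excludes [gmin (lam A) = +oo]. *)
have [c [c0 cI]] : exists c, 0 < c /\ fine I < A * c.
  exists (fine I / A + 1); split; first by rewrite ltr_wpDl ?divr_ge0// ltW.
  by rewrite mulrDr mulr1 mulrC divfK ?gt_eqF// ltrDl.
move: key; case: (gmin (lam A)) => [r| |] key.
- rewrite -EFinM lee_fin leNgt; apply/negP => Ir.
  have r0 : 0 < r by rewrite -(pmulr_rgt0 _ A0); exact: le_lt_trans Ir.
  (* [key] requires [c] strictly below [gmin]; this [e] puts [A * (r - e)] halfway between [fine I]
     and [A * r], still above [fine I]. *)
  pose e := (A * r - fine I) / (2 * A).
  have Ae : A * e = (A * r - fine I) / 2 by rewrite /e; field; rewrite gt_eqF.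
  have e0 : 0 < e by rewrite -(pmulr_rgt0 _ A0) Ae; lra.
  have re : 0 < r - e by rewrite -(pmulr_rgt0 _ A0) mulrBr Ae; lra.
  have := key (r - e) re; rewrite lte_fin ltrBlDr ltrDl mulrBr Ae => /(_ e0).
  by lra.
- by have := key c c0 (ltry _); rewrite leNgt cI.
- by rewrite gt0_muleNy ?lte_fin// leNye.
Qed.
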